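(* Let $n\ge 3$ and $1\le k\le n-1$ be integers with $k\ne n-2$. Let $P_n^k$ be the graph obtained from the complete graph $K_{n-k}$ by adding $k$ new vertices, each adjacent only to one fixed vertex of $K_{n-k}$. Then $P_n^k\in\mathfrak{H}_{n,k}$, $\mu(P_n^k)=1$, and $\mu(G)\le 1=\mu(P_n^k)$ for every $G\in\mathfrak{H}_{n,k}$.
   Context: All graphs are finite, simple and undirected. The Laplacian matrix of $G$ is $L(G)=D(G)-A(G)$ (degree matrix minus adjacency matrix), and the algebraic connectivity $\mu(G)$ is the second smallest eigenvalue of $L(G)$. A pendant vertex is a vertex of degree one. $\mathfrak{H}_{n,k}$ denotes the class of all connected graphs on $n$ vertices having exactly $k$ pendant vertices. *)

(* Defs.v *)
From mathcomp Require Import all_boot all_order all_algebra.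
From mathcomp Require Import polyrcf.
From mathcomp Require Export reals.

Set Implicit Arguments.
Unset Strict Implicit.
Unset Printing Implicit Defensive.

Import Order.TTheory GRing.Theory Num.Theory.
Local Open Scope ring_scope.

Record sgraph (T : finType) := SGraph {
  adj :> rel T;
  adj_sym : symmetric adj;
  adj_irrefl : irreflexive adj
}.

Section Graphs.
Variables (T : finType) (G : sgraph T).

Definition degree (x : T) : nat := #|[set y | adj G x y]|.

Definition pendant_vertices : {set T} := [set x | degree x == 1%N].

(* This also holds of the graph with no vertex. *)
Definition connected_graph : Prop := forall x y : T, connect (adj G) x y.

Definition pendant_class (n k : nat) : Prop :=
  [/\ #|T| = n, connected_graph & #|pendant_vertices| = k].

End Graphs.

(* Rows and columns follow the enumeration of T. *)
Section Laplacian.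
Variables (R : nzRingType) (T : finType) (G : sgraph T).

Definition degree_mx : 'M[R]_#|T| :=
  diag_mx (\row_i (degree G (enum_val i))%:R).

Definition adjacency_mx : 'M[R]_#|T| :=
  \matrix_(i, j) (adj G (enum_val i) (enum_val j))%:R.

Definition laplacian : 'M[R]_#|T| := degree_mx - adjacency_mx.

End Laplacian.

(* The eigenvalues of A lying in R, in nondecreasing order and repeated
   according to their algebraic multiplicity: [rootsR p] is the increasing
   list of the distinct roots of p, and [mup x p] the multiplicity of x. For a
   symmetric A, such as a Laplacian, this list contains all n eigenvalues. *)
Definition eigenvalues (R : rcfType) (n : nat) (A : 'M[R]_n) : seq R :=
  flatten [seq nseq (mup x (char_poly A)) x | x <- rootsR (char_poly A)].

(* Second smallest eigenvalue counted with multiplicity; the value is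
   meaningful for graphs with at least two vertices. *)
Definition algebraic_connectivity (R : rcfType) (T : finType) (G : sgraph T) : R :=
  nth 0 (eigenvalues (laplacian R G)) 1.

(* Vertices [inl i] form the complete graph K_m; each of the k new vertices
   [inr j] is adjacent to [inl v] only. *)
Section CliqueWithPendants.
Variables (m k : nat) (v : 'I_m).

Definition clique_pendants_adj : rel ('I_m + 'I_k)%type := fun x y =>
  match x, y with
  | inl i, inl j => i != j
  | inl i, inr _ => i == v
  | inr _, inl j => j == v
  | inr _, inr _ => false
  end.

Lemma clique_pendants_sym : symmetric clique_pendants_adj.
Proof. by move=> [i|i] [j|j] //=; rewrite eq_sym. Qed.

Lemma clique_pendants_irrefl : irreflexive clique_pendants_adj.
Proof. by move=> [i|i] //=; rewrite eqxx. Qed.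

Definition clique_pendants : sgraph ('I_m + 'I_k)%type :=
  SGraph clique_pendants_sym clique_pendants_irrefl.

End CliqueWithPendants.

(* The graph P_n^k, with v the fixed vertex of K_(n - k). *)
Definition Pnk (n k : nat) (v : 'I_(n - k)) : sgraph ('I_(n - k) + 'I_k)%type :=
  clique_pendants k v.

(* Main.v *)
Require Import Defs.
From mathcomp Require Import all_boot all_order all_algebra.
From mathcomp Require Import polyrcf complex sesquilinear spectral.
From mathcomp Require Import zify ring.

(* Unitary diagonalization of a real symmetric matrix A over R[i] gives the two
   Courant-Fischer bounds on its second eigenvalue: the Rayleigh quotient of a
   single vector orthogonal to a null vector of A bounds it from above, and a
   bound on the Rayleigh quotient over a whole hyperplane bounds it from below.
   For the upper bound, removing the neighbour v of a pendant vertex w separates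
   w from the rest, so a vector that vanishes at v and is constant on each of
   the two sides has Rayleigh quotient at most 1. For the lower bound, the fixed
   vertex v of P_n^k is adjacent to all others, so when sum f = 0 the Laplacian
   form is at least sum_t (f t - f v)^2 = sum_t (f t)^2 + n (f v)^2. *)

Set Implicit Arguments.
Unset Strict Implicit.
Unset Printing Implicit Defensive.

Import Order.TTheory GRing.Theory Num.Theory.
Local Open Scope ring_scope.
Local Open Scope sesquilinear_scope.

(** * Sorted eigenvalue lists and characteristic polynomials *)

Lemma count_flatten_nseq (T : eqType) (f : T -> nat) (r : seq T) (x : T) :
  uniq r ->
  count_mem x (flatten [seq nseq (f y) y | y <- r]) = if x \in r then f x else 0%N.
Proof.
elim: r => //= y r IH /andP[yr ur]; rewrite count_cat count_nseq IH //= inE.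
rewrite [y == x]eq_sym; case: eqVneq => [->|_] /=; last by rewrite mul0n.
by rewrite (negPf yr) mul1n addn0.
Qed.

Lemma flatten_nseq_sorted (R : realDomainType) (f : R -> nat) (r : seq R) :
  sorted <%R r -> sorted <=%R (flatten [seq nseq (f y) y | y <- r]).
Proof.
elim: r => //= y r IH yr; have {}IH := IH (path_sorted yr).
elim: (f y) => //= m IHm; rewrite (path_sortedE le_trans) IHm andbT.
rewrite all_cat all_nseq lexx orbT /=; apply/allP => z /flattenP[s].
case/mapP => t tr -> /nseqP[-> _].
by move: yr; rewrite (path_sortedE lt_trans) => /andP[/allP/(_ _ tr)/ltW].
Qed.

Lemma mup_prod_XsubC (F : fieldType) (s : seq F) (x : F) :
  mup x (\prod_(a <- s) ('X - a%:P)) = count_mem x s.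
Proof.
elim: s => [|a s IH]; first by rewrite big_nil mupNroot // root1.
rewrite big_cons mupM ?polyXsubC_eq0 ?IH //=; last first.
  by rewrite monic_neq0 // monic_prod_XsubC.
by rewrite -[X in mup x X]expr1 mup_XsubCX; case: (a == x).
Qed.

Section Eigenvalues.
Variables (R : rcfType) (n : nat) (A : 'M[R]_n).

Lemma eigenvalues_sorted : sorted <=%R (eigenvalues A).
Proof. by apply: flatten_nseq_sorted; apply: sorted_roots. Qed.

Lemma perm_eigenvalues (s : seq R) :
  char_poly A = \prod_(a <- s) ('X - a%:P) -> perm_eq (eigenvalues A) s.
Proof.
move=> As; apply/allP => x _ /=; apply/eqP.
rewrite /eigenvalues count_flatten_nseq ?uniq_roots //.
have p0 : char_poly A != 0 by rewrite monic_neq0 // char_poly_monic.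
have := roots_on_rootsR p0 x; rewrite in_itv /= => <-.
by rewrite As root_prod_XsubC mup_prod_XsubC; case: ifP => // /count_memPn.
Qed.

End Eigenvalues.

(** Two entries at most [c] force length at least 2, so [nth] never falls back on its default 0. *)
Lemma sorted_nth1_le (R : realDomainType) (s : seq R) (c : R) :
  sorted <=%R s -> (1 < count (<= c) s)%N -> nth 0 s 1 <= c.
Proof.
case: s => [|a [|b s]] //=; first by rewrite addn0 ltnNge leq_b1.
case/andP=> ab bs; have [//|cb] := leP b c.
rewrite (_ : count _ s = 0%N) ?addn0 ?add0n; first by case: (a <= c).
apply/eqP; rewrite -leqn0 leqNgt -has_count; apply/hasPn => x xs /=.
rewrite -ltNge (lt_le_trans cb) //.
by have /allP := order_path_min le_trans bs; apply.
Qed.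

Lemma sorted_nth1_ge (R : realDomainType) (s : seq R) (c : R) :
  sorted <=%R s -> (1 < size s)%N -> (count (< c) s <= 1)%N -> c <= nth 0 s 1.
Proof.
case: s => [|a [|b s]] //= /andP[ab bs] _; rewrite leNgt.
by apply: contraTN => bc; rewrite bc (le_lt_trans ab bc).
Qed.

Lemma char_poly_conj (R : comUnitRingType) n (P A : 'M[R]_n) :
  P \in unitmx -> char_poly (invmx P *m A *m P) = char_poly A.
Proof.
move=> Pu; rewrite /char_poly.
have -> : char_poly_mx (invmx P *m A *m P) =
    map_mx polyC (invmx P) *m char_poly_mx A *m map_mx polyC P.
  rewrite /char_poly_mx mulmxBr mulmxBl !map_mxM scalar_mxC; congr (_ - _).
  by rewrite -mulmxA -map_mxM mulVmx // map_mx1 mulmx1.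
rewrite !det_mulmx mulrAC -det_mulmx -map_mxM mulVmx // map_mx1 det1.
by rewrite mul1r.
Qed.

(** * Unitary diagonalization and the two bounds on the second eigenvalue *)

Section SymmetricMatrix.
Variables (R : rcfType) (n : nat) (A : 'M[R]_n).
Hypothesis A_sym : A^T = A.
Local Notation C := R[i].
Local Notation toC := (map_mx (real_complex R)).

(** Over [R[i]] the matrix is Hermitian, hence normal. Its eigenvalues are real, so [d] descends to
    [R], while [P] may keep complex entries. *)
Lemma real_spectral_theorem :
  exists (P : 'M[C]_n) (d : 'rV[R]_n),
    P \is unitarymx /\ toC A = P^t* *m diag_mx (toC d) *m P.
Proof.
have Aherm : toC A \is hermsymmx.
  apply: realsym_hermsym.
    by apply/is_hermitianmxP; rewrite expr0 scale1r map_mx_id // map_trmx A_sym.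
  by apply/mxOverP => i j; rewrite mxE complex_real.
have /mxOverP dreal := hermitian_spectral_diag_real Aherm.
have /orthomx_spectralP AE := hermitian_normalmx Aherm.
exists (spectralmx (toC A)), (map_mx (@complex.Re R) (spectral_diag (toC A))).
have Pu := spectral_unitarymx (toC A); split=> //.
rewrite -invmx_unitary // [LHS]AE; congr (_ *m diag_mx _ *m _).
by apply/rowP => i; rewrite !mxE; apply/esym/RRe_real.
Qed.

Section Decomposition.
Variables (P : 'M[C]_n) (d : 'rV[R]_n).
Hypotheses (P_unitary : P \is unitarymx).
Hypotheses (AE : toC A = P^t* *m diag_mx (toC d) *m P).

Lemma char_poly_decomposition :
  char_poly A = \prod_(a <- codom (d 0)) ('X - a%:P).
Proof.
apply: (@map_poly_inj _ _ (real_complex R)).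
rewrite map_char_poly AE -invmx_unitary //.
have Pun := unitarymx_unit P_unitary.
rewrite char_poly_conj //.
rewrite char_poly_trig ?diag_mx_is_trig // rmorph_prod /= big_map.
rewrite big_enum; apply: eq_bigr => i _.
by rewrite rmorphB /= map_polyX map_polyC /= !mxE eqxx.
Qed.

Lemma perm_eigenvalues_diag : perm_eq (eigenvalues A) (codom (d 0)).
Proof. exact/perm_eigenvalues/char_poly_decomposition. Qed.

Lemma count_eigenvalues (p : pred R) :
  count p (eigenvalues A) = #|[pred i | p (d 0 i)]|.
Proof.
by rewrite (permP perm_eigenvalues_diag) count_map cardE size_filter -enumT.
Qed.

(** Here [y] lists the coordinates of [y *m P] in the orthonormal eigenbasis formed by the rows of
    [P]. *)
Lemma diag_form (y : 'rV[C]_n) :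
  (y *m P *m toC A *m (y *m P)^t*) 0 0 = \sum_i (d 0 i)%:C%C * `|y 0 i| ^+ 2.
Proof.
rewrite AE trmx_mul map_mxM !mulmxA.
rewrite mulmxtVK // mulmxtVK // mul_mx_diag mxE; apply: eq_bigr => i _.
by rewrite !mxE normCK mulrAC mulrC.
Qed.

Lemma diag_dot (y z : 'rV[C]_n) :
  ((y *m P) *m (z *m P)^t*) 0 0 = \sum_i y 0 i * (z 0 i)^*.
Proof.
rewrite trmx_mul map_mxM !mulmxA mulmxtVK // mxE; apply: eq_bigr => i _.
by rewrite !mxE.
Qed.

End Decomposition.

Lemma trmxC_real m (M : 'M[R]_(m, n)) : (toC M)^t* = toC M^T.
Proof.
rewrite realmxC ?map_trmx //.
by apply/mxOverP => i j; rewrite !mxE complex_real.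
Qed.

(** Suppose at most one eigenvalue is at most [c]. It is then the eigenvalue 0 of [u], so [v], being
    orthogonal to [u], lies in the span of eigenvectors with eigenvalue above [c], and the bound on
    its form forces [v = 0]. *)
Lemma second_eigenvalue_le (u v : 'rV[R]_n) (c : R) :
    0 <= c -> u != 0 -> u *m A = 0 -> v != 0 -> u *m v^T = 0 ->
    (v *m A *m v^T) 0 0 <= c * (v *m v^T) 0 0 ->
  nth 0 (eigenvalues A) 1 <= c.
Proof.
move=> c0 u0 uA v0 uv vA; apply: sorted_nth1_le; first exact: eigenvalues_sorted.
have [P [d [Pu AE]]] := real_spectral_theorem.
rewrite (count_eigenvalues Pu AE); apply: contraR v0; rewrite -leqNgt => card1.
have Pun := unitarymx_unit Pu.
have [z zE] : exists z, z *m P = toC u by exists (toC u *m P^t*); rewrite mulmxKtV.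
have [y yE] : exists y, y *m P = toC v by exists (toC v *m P^t*); rewrite mulmxKtV.
have zd i : z 0 i * (d 0 i)%:C%C = 0.
  have : toC u *m toC A = 0 by rewrite -map_mxM uA map_mx0.
  rewrite -zE AE !mulmxA mulmxtVK // => /(congr1 (mulmx^~ (invmx P))).
  rewrite mulmxK // mul0mx mul_mx_diag => /rowP/(_ i).
  by rewrite !mxE.
have [i0 zi0] : exists i, z 0 i != 0.
  have : z != 0.
    apply: contra_neq u0 => z0; move: zE; rewrite z0 mul0mx => /esym/eqP.
    by rewrite map_mx_eq0 => /eqP.
  by case/rV0Pn => i; exists i.
have di0 : d 0 i0 = 0.
  by have /eqP := zd i0; rewrite mulf_eq0 (negPf zi0) fmorph_eq0 => /eqP.
have d_gt i : i != i0 -> c < d 0 i.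
  move=> ii0; rewrite ltNge; apply: contraL card1 => dic.
  rewrite -ltnNge; apply/card_gt1P; exists i, i0.
  by rewrite !inE dic di0 c0.
(* All other eigenvalues are positive, so [u] has [i0] as its only nonzero coordinate and
   orthogonality concerns that coordinate alone. *)
have yi0 : y 0 i0 = 0.
  have := diag_dot Pu z y; rewrite zE yE trmxC_real -map_mxM uv !mxE.
  rewrite (bigD1 i0) //= big1 => [/esym/eqP|i ii0].
    by rewrite addr0 mulf_eq0 (negPf zi0) conjC_eq0 => /eqP.
  have /eqP := zd i; rewrite mulf_eq0 fmorph_eq0 => /orP[/eqP->|/eqP di].
    by rewrite mul0r.
  by have := d_gt i ii0; rewrite di ltNge c0.
have ycd i : 0 <= (d 0 i - c)%:C%C * `|y 0 i| ^+ 2.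
  have [->|ii0] := eqVneq i i0; first by rewrite yi0 normr0 expr0n mulr0.
  by rewrite mulr_ge0 ?exprn_ge0 // ler0c subr_ge0 ltW ?d_gt.
(* In eigenbasis coordinates this sum is the form of [v] minus [c] times its squared norm. *)
have : \sum_i (d 0 i - c)%:C%C * `|y 0 i| ^+ 2 <= 0.
  under eq_bigr do rewrite rmorphB mulrBl /=.
  rewrite sumrB -mulr_sumr -(diag_form Pu AE).
  under [in X in _ * X]eq_bigr do rewrite normCK.
  rewrite -(diag_dot Pu) yE trmxC_real -!map_mxM !mxE subr_le0.
  by rewrite -rmorphM lecR; move: vA; rewrite !mxE.
move=> le0; have /eqP : \sum_i (d 0 i - c)%:C%C * `|y 0 i| ^+ 2 = 0.
  by apply: le_anti; rewrite le0 sumr_ge0.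
rewrite psumr_eq0 // => /allP y0.
have {}y0 : y = 0.
  apply/rowP => i; rewrite !mxE; have [->//|ii0] := eqVneq i i0.
  have := y0 i (mem_index_enum _); rewrite mulf_eq0 expf_eq0 normr_eq0 /=.
  by rewrite fmorph_eq0 subr_eq0 gt_eqF ?d_gt //= => /eqP.
move: yE; rewrite y0 mul0mx => /esym/eqP.
by rewrite map_mx_eq0.
Qed.

(** The cross terms between real and imaginary parts cancel because [A] is symmetric. This lets
    hypotheses on real vectors be applied to complex eigenvectors. *)
Lemma complex_form (x : 'rV[C]_n) :
  (x *m toC A *m x^t*) 0 0 =
    ((map_mx (@complex.Re R) x *m A *m (map_mx (@complex.Re R) x)^T) 0 0 +
     (map_mx (@complex.Im R) x *m A *m (map_mx (@complex.Im R) x)^T) 0 0)%:C%C.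
Proof.
set a := map_mx (@complex.Re R) x; set b := map_mx (@complex.Im R) x.
have -> : x = toC a + 'i *: toC b.
  by apply/rowP => j; rewrite !mxE [LHS]complexE.
have conjE : (toC a + 'i *: toC b)^t* = toC a^T - 'i *: toC b^T.
  by rewrite !linearD /= linearZ /= map_mxD map_mxZ /= !trmxC_real conjCi scaleNr.
have ba : a *m A *m b^T = b *m A *m a^T.
  rewrite [LHS]mx11_scalar -tr_scalar_mx -mx11_scalar.
  by rewrite !trmx_mul A_sym trmxK mulmxA.
rewrite conjE !mulmxDl !mulmxBr -!scalemxAl -!scalemxAr -!map_mxM ba.
rewrite scalerA -expr2 sqrCi scaleN1r opprK addrA subrK.
by rewrite -map_mxD !mxE.
Qed.

End SymmetricMatrix.

(** Two eigenvalues below [c] would give a plane of eigenvectors meeting the hyperplane orthogonal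
    to [u]. A nonzero vector there has form below [c] times its squared norm, against the hypothesis
    applied to its real and imaginary parts. *)
Lemma second_eigenvalue_ge (R : rcfType) n (A : 'M[R]_n) (u : 'rV[R]_n) (c : R) :
    A^T = A -> (1 < n)%N ->
    (forall x : 'rV[R]_n, u *m x^T = 0 ->
       c * (x *m x^T) 0 0 <= (x *m A *m x^T) 0 0) ->
  c <= nth 0 (eigenvalues A) 1.
Proof.
move=> A_sym n1 ucA.
have [P [d [Pu AE]]] := real_spectral_theorem A_sym.
have size_ev : size (eigenvalues A) = n.
  by rewrite -count_predT (count_eigenvalues Pu AE) -[RHS]card_ord; apply: eq_card.
apply: sorted_nth1_ge; rewrite ?size_ev ?eigenvalues_sorted //.
rewrite (count_eigenvalues Pu AE) leqNgt; apply/negP => /card_gt1P[i [j]].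
rewrite !inE => -[di dj ij].
(* Two eigenvalues below c: some nonzero combination y P of their eigenvectors,
   rows i and j of P, is orthogonal to u. *)
have [z zE] : exists z, z *m P = map_mx (real_complex R) u.
  by exists (map_mx (real_complex R) u *m P^t*); rewrite mulmxKtV.
have [al [be [ab0 zab]]] : exists al be : R[i],
    (al != 0) || (be != 0) /\ z 0 i * al^* + z 0 j * be^* = 0.
  have [z0|z0] := eqVneq (z 0 i) 0; last first.
    exists (z 0 j)^*, (- (z 0 i)^*); rewrite oppr_eq0 !conjC_eq0 z0 orbT.
    by rewrite rmorphN /= !conjCK mulrN mulrC subrr.
  by exists 1, 0; rewrite oner_eq0 z0 conjC0 mul0r mulr0 addr0.
pose y := al *: delta_mx 0 i + be *: delta_mx 0 j : 'rV[R[i]]_n.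
have sumy (F : 'I_n -> R[i] -> R[i]) : (forall k, F k 0 = 0) ->
    \sum_k F k (y 0 k) = F i al + F j be.
  move=> F0; rewrite (bigD1 i) //= (bigD1 j) 1?eq_sym //= big1 ?addr0.
    rewrite !mxE !eqxx [j == i]eq_sym (negPf ij) /=.
    by rewrite !mulr0 !mulr1 addr0 add0r.
  move=> k /andP[ki kj].
  by rewrite !mxE !eqxx (negPf ki) (negPf kj) !mulr0 addr0 F0.
pose x := y *m P; pose a := map_mx (@complex.Re R) x.
pose b := map_mx (@complex.Im R) x.
have yform := diag_form Pu AE y.
rewrite (complex_form A_sym) -/x -/a -/b in yform.
rewrite (sumy (fun k t => (d 0 k)%:C%C * `|t| ^+ 2)) in yform; last first.
  by move=> k; rewrite normr0 expr0n mulr0.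
(* For the identity matrix the form is the squared norm. *)
have ynorm := complex_form (trmx1 R n) x.
rewrite map_mx1 !mulmx1 (diag_dot Pu y y) -/a -/b in ynorm.
rewrite (sumy (fun k t => t * t^*)) in ynorm; last by move=> k; rewrite mul0r.
(* Since [u] is real, the real and imaginary parts of its vanishing product with [x] vanish
   separately. *)
have [ua ub] : u *m a^T = 0 /\ u *m b^T = 0.
  have := diag_dot Pu z y.
  rewrite (sumy (fun k t => z 0 k * t^*)) ?zab ?zE => [|k]; last first.
    by rewrite conjC0 mulr0.
  rewrite -/x.
  have -> : x = map_mx (real_complex R) a + 'i *: map_mx (real_complex R) b.
    by apply/rowP => k; rewrite !mxE [LHS]complexE.
  rewrite linearD linearZ /= map_mxD map_mxZ /= !trmxC_real conjCi.
  rewrite scaleNr mulmxBr -scalemxAr -!map_mxM.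
  move: (u *m a^T) (u *m b^T) => s t; rewrite !mxE => /eqP.
  rewrite [s]mx11_scalar [t]mx11_scalar !mxE !mulr1n.
  move: (s 0 0) (t 0 0) => {}s {}t /=.
  simpc; rewrite eq_complex /= oppr_eq0 => /andP[/eqP-> /eqP->].
  by rewrite raddf0.
have := ucA _ ua; have := ucA _ ub; move=> hb ha; have := lerD ha hb.
rewrite -mulrDr -lecR [(c * _)%:C%C]rmorphM /= yform -ynorm -!normCK mulrDr => le_c.
have lt_or (t : R[i]) k : d 0 k < c ->
    (d 0 k)%:C%C * `|t| ^+ 2 <= c%:C%C * `|t| ^+ 2 ?= iff (t == 0).
  move=> dk; split; first by rewrite ler_wpM2r ?exprn_ge0 // lecR ltW.
  rewrite -subr_eq0 -mulrBl mulf_eq0 expf_eq0 normr_eq0 /= -rmorphB.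
  by rewrite fmorph_eq0 subr_eq0 lt_eqF.
(* The two opposite inequalities give equality, which the strict bounds allow only when both
   coefficients vanish. *)
have := leifD (lt_or al _ di) (lt_or be _ dj).
case=> ge_c; rewrite eq_le ge_c le_c /= => /esym/andP[/eqP al0 /eqP be0].
by move: ab0; rewrite al0 be0 eqxx.
Qed.

(** * The Laplacian quadratic form, with vectors seen as functions on vertices *)

Section LaplacianForm.
Variables (R : rcfType) (T : finType) (G : sgraph T).
Local Notation L := (laplacian R G).

Definition fun_row (f : T -> R) : 'rV[R]_#|T| := \row_i f (enum_val i).

Lemma fun_row_dot f g : (fun_row f *m (fun_row g)^T) 0 0 = \sum_t f t * g t.
Proof.
rewrite mxE (big_enum_val (fun t => f t * g t)).
by apply: eq_bigr => i _; rewrite !mxE.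
Qed.

Lemma fun_row_neq0 f t : f t != 0 -> fun_row f != 0.
Proof.
by move=> ft; apply/rV0Pn; exists (enum_rank t); rewrite mxE enum_rankK.
Qed.

Lemma fun_row_surj (x : 'rV[R]_#|T|) : exists f, x = fun_row f.
Proof.
exists (fun t => x 0 (enum_rank t)).
by apply/rowP => i; rewrite mxE enum_valK.
Qed.

Lemma laplacian_sym : L^T = L.
Proof.
apply/matrixP => i j; rewrite !mxE adj_sym; congr (_ - _).
by rewrite eq_sym; case: eqVneq => // ->.
Qed.

Lemma fun_row_laplacian f :
  fun_row f *m L = fun_row (fun t => \sum_s (adj G t s)%:R * (f t - f s)).
Proof.
apply/rowP => j; rewrite mulmxBr mul_mx_diag !mxE.
under [RHS]eq_bigr do rewrite mulrBr.
rewrite sumrB -mulr_suml; congr (_ - _).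
  rewrite mulrC; congr (_ * _); rewrite /degree cardsE -sum1_card natr_sum.
  rewrite big_mkcond /=; apply: eq_bigr => s _.
  by rewrite -topredE /=; case: (adj G _ _).
rewrite (big_enum_val (fun s => (adj G (enum_val j) s)%:R * f s)).
by apply: eq_bigr => i _; rewrite !mxE adj_sym mulrC.
Qed.

Lemma laplacian_form f :
  (fun_row f *m L *m (fun_row f)^T) 0 0 =
    \sum_t (\sum_s (adj G t s)%:R * (f t - f s)) * f t.
Proof. by rewrite fun_row_laplacian fun_row_dot. Qed.

(** The sum runs over ordered pairs and meets each edge twice, hence the doubled form. *)
Lemma laplacian_form_sqr f :
  (fun_row f *m L *m (fun_row f)^T) 0 0 *+ 2 =
    \sum_t \sum_s (adj G t s)%:R * (f t - f s) ^+ 2.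
Proof.
rewrite laplacian_form mulr2n.
under eq_bigr do rewrite mulr_suml.
rewrite [X in _ + X]exchange_big /= -big_split /=; apply: eq_bigr => t _.
rewrite -big_split /=; apply: eq_bigr => s _.
by rewrite [adj G s t]adj_sym; ring.
Qed.

Lemma pendant_connectivity_le1 w :
  (2 < #|T|)%N -> w \in pendant_vertices G -> algebraic_connectivity R G <= 1.
Proof.
move=> T3; rewrite inE => /cards1P[v] Nw.
have adjw s : adj G w s = (s == v) by move/setP/(_ s): Nw; rewrite !inE.
have wv : w != v by rewrite -adjw adj_irrefl.
(* The value at [w] balances the ones on the [#|T| - 2] vertices other than [v] and [w], making [b]
   orthogonal to the constants. *)
pose b t : R := if t == v then 0 else if t == w then 2 - #|T|%:R else 1.
have bv : b v = 0 by rewrite /b eqxx.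
have b1 t : t != v -> t != w -> b t = 1 by rewrite /b => /negPf-> /negPf->.
(* A third vertex makes [b] nonzero; with two vertices the value at [w] would be 0 too. *)
have [t0 t0v t0w] : exists2 t, t != v & t != w.
  have : (0 < #|~: [set v; w]|)%N.
    by have := cardsC [set v; w]; rewrite cards2; lia.
  by case/card_gt0P => t; rewrite !inE negb_or => /andP[]; exists t.
apply: (second_eigenvalue_le laplacian_sym
    (u := fun_row (fun=> 1)) (v := fun_row b)).
- exact: ler01.
- by apply: (fun_row_neq0 (t := v)); rewrite oner_eq0.
- rewrite fun_row_laplacian; apply/rowP => i; rewrite !mxE big1 // => s _.
  by rewrite subrr mulr0.
- by apply: (fun_row_neq0 (t := t0)); rewrite b1 // oner_eq0.
- apply/matrixP => i j; rewrite !ord1 fun_row_dot [RHS]mxE.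
  rewrite (bigD1 v) //= (bigD1 w) //= bv /b (negPf wv) eqxx mulr0 add0r mul1r.
  rewrite (eq_bigr (fun=> 1)) => [|t /andP[tv tw]]; last first.
    by rewrite (negPf tv) (negPf tw) mul1r.
  rewrite sumr_const.
  have -> : #|[pred t | (t != v) && (t != w)]| = (#|T| - 2)%N.
    have := cardsC [set v; w]; rewrite cards2 eq_sym wv => <-.
    rewrite addKn; apply: eq_card => t.
    by rewrite !inE negb_or.
  by rewrite natrB ?(ltnW T3) //; ring.
(* The comparison holds vertex by vertex: away from [v], [b] is constant across edges, so only a
   possible edge to [v] contributes, with weight at most 1. *)
rewrite laplacian_form fun_row_dot mul1r; apply: ler_sum => t _.
have [->|tv] := eqVneq t v; first by rewrite bv !mulr0.
have [->|tw] := eqVneq t w.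
  rewrite (bigD1 v) //= big1 => [|s sv]; last by rewrite adjw (negPf sv) mul0r.
  by rewrite adjw eqxx bv addr0 subr0 mul1r.
rewrite b1 // !mulr1 (bigD1 v) //= big1 => [|s sv].
  by rewrite bv addr0 subr0 mulr1 lern1 leq_b1.
have [->|sw] := eqVneq s w; first by rewrite adj_sym adjw (negPf tv) mul0r.
by rewrite b1 // subrr mulr0.
Qed.

Lemma dominating_connectivity_ge1 v :
    (1 < #|T|)%N -> (forall t, t != v -> adj G v t) ->
  1 <= algebraic_connectivity R G.
Proof.
move=> T2 domv.
apply: (second_eigenvalue_ge (u := fun_row (fun=> 1)) laplacian_sym T2) => x.
have [f ->] := fun_row_surj x.
move=> /matrixP/(_ 0 0); rewrite fun_row_dot mxE => f0.
have {}f0 : \sum_t f t = 0 by rewrite -[RHS]f0; apply: eq_bigr => t _; rewrite mul1r.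
rewrite -(ler_pMn2r (ltn0Sn 1)) laplacian_form_sqr fun_row_dot mul1r.
(* Only the edges at [v] are kept. The pair [(v, v)] gets weight 2, but its difference is zero. *)
apply: le_trans
  (_ : \sum_t \sum_s ((t == v)%:R + (s == v)%:R) * (f t - f s) ^+ 2 <= _).
  under [leRHS]eq_bigr do under eq_bigr do rewrite mulrDl.
  under [leRHS]eq_bigr do rewrite big_split.
  rewrite big_split /= [X in _ <= _ + X]exchange_big /=.
  have star (h : T -> R) : \sum_t (t == v)%:R * h t = h v.
    rewrite (bigD1 v) //= eqxx mul1r big1 ?addr0 // => t /negPf->.
    by rewrite mul0r.
  under [X in _ <= X + _]eq_bigr do rewrite -mulr_sumr.
  under [X in _ <= _ + X]eq_bigr do rewrite -mulr_sumr.
  rewrite !star.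
  under [X in _ <= _ + X]eq_bigr do rewrite -sqrrN opprB.
  rewrite -mulr2n ler_pMn2r //.
  (* In the expanded square the cross term is a multiple of the sum of [f], which is zero; the
     excess is [#|T|] times the square of [f v]. *)
  under [leRHS]eq_bigr => s _ do rewrite sqrrB.
  rewrite big_split /= sumrB sumr_const.
  under [X in _ - X]eq_bigr do rewrite -mulrnAr.
  rewrite -mulr_sumr sumrMnl f0 mul0rn mulr0 subr0.
  under [leLHS]eq_bigr do rewrite -expr2.
  by rewrite lerDr mulrn_wge0 // sqr_ge0.
apply: ler_sum => t _; apply: ler_sum => s _.
have [->|ts] := eqVneq t s; first by rewrite subrr expr0n !mulr0.
apply: ler_wpM2r; rewrite ?sqr_ge0 //.
have [tv|tv] := eqVneq t v.
  by rewrite tv eq_sym -tv (negPf ts) tv domv ?addr0 // eq_sym -tv.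
have [->|sv] := eqVneq s v; first by rewrite adj_sym domv // add0r.
by rewrite addr0 ler0n.
Qed.

End LaplacianForm.

(** * The extremal graph and the final statement *)

(** Clique vertices must have degree at least 2. For [m = 2] the clique vertex other than [v] would
    itself be pendant. *)
Lemma clique_pendants_class m k (v : 'I_m) :
    m <> 2%N -> (2 < m + k)%N -> (0 < k)%N ->
  pendant_class (clique_pendants k v) (m + k) k.
Proof.
move=> m2 mk k0; set G := clique_pendants k v.
have adj_inl t : t != inl v -> adj G (inl v) t.
  by case: t => [i|j] /=; rewrite ?eqxx // eq_sym.
split.
- by rewrite card_sum !card_ord.
- have cv t : connect (adj G) (inl v) t.
    have [->//|tv] := eqVneq t (inl v); exact/connect1/adj_inl.
  move=> x y; apply: connect_trans (cv y).
  by rewrite (sym_connect_sym (adj_sym G)).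
have -> : pendant_vertices G = [set inr j | j in [set: 'I_k]].
  apply/setP => -[i|j]; rewrite inE.
    rewrite [RHS](_ : _ = false); last by apply/imsetP => -[].
    apply/negbTE; rewrite neq_ltn; apply/orP; right; rewrite /degree.
    (* If [m = 1] the graph is a star whose centre has [k >= 2] leaves; otherwise [m >= 3] and the
       clique alone supplies two neighbours. *)
    have [m1|m1] := eqVneq m 1%N.
      have iv : i = v by apply/val_inj => /=; move: (ltn_ord i) (ltn_ord v); lia.
      have : (1 < #|[set @inr 'I_m 'I_k j | j in [set: 'I_k]]|)%N.
        by rewrite card_imset ?cardsT ?card_ord; [lia | exact: inr_inj].
      move=> /leq_trans; apply; apply/subset_leq_card/subsetP => _ /imsetP[j _ ->].
      by rewrite inE /= iv.
    have : (1 < #|[set @inl 'I_m 'I_k j | j in [set~ i]]|)%N.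
      rewrite card_imset; last exact: inl_inj.
      by have := cardsC1 i; rewrite card_ord; have := ltn_ord i; lia.
    move=> /leq_trans; apply; apply/subset_leq_card/subsetP => _ /imsetP[j ji ->].
    by move: ji; rewrite !inE eq_sym.
  rewrite imset_f ?inE //; apply/cards1P; exists (inl v).
  by apply/setP => -[i|i]; rewrite !inE /=.
by rewrite card_imset ?cardsT ?card_ord //; apply: inr_inj.
Qed.

Theorem theorem4p1 (R : realType) (n k : nat)
    (hn : (3 <= n)%N) (hk1 : (1 <= k)%N) (hkn : (k <= n - 1)%N)
    (hk : k <> (n - 2)%N) (v : 'I_(n - k)) :
  [/\ pendant_class (Pnk v) n k,
      algebraic_connectivity R (Pnk v) = 1
    & forall (T : finType) (G : sgraph T), pendant_class G n k ->
        algebraic_connectivity R G <= 1].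
Proof.
have ub (T : finType) (G : sgraph T) : pendant_class G n k ->
    algebraic_connectivity R G <= 1.
  case=> Tn _ Gk; have /card_gt0P[w wG] : (0 < #|pendant_vertices G|)%N by rewrite Gk.
  by apply: pendant_connectivity_le1 wG; rewrite Tn.
have Pclass : pendant_class (Pnk v) n k.
  (* Only the vertex count is rewritten, so that the type of [v] stays intact. *)
  have -> : pendant_class (Pnk v) n k = pendant_class (Pnk v) (n - k + k) k.
    by rewrite subnK //; lia.
  by apply: clique_pendants_class; lia.
split=> //; apply: le_anti; rewrite ub //=.
apply: (@dominating_connectivity_ge1 _ _ _ (inl v)).
  by case: Pclass => -> *; lia.
by case=> [i|j] /=; rewrite ?eqxx // eq_sym.
Qed.
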